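(* Let $d>1000$. Consider reality testing for pure states $\ket{\psi}\in\mathbb{C}^d$, where the input is given via a state preparation unitary $U\in\mathbb{C}^{2d^2\times 2d^2}=(\mathbb{C}^{2d\times 2d})_{\mathsf A}\otimes(\mathbb{C}^{d\times d})_{\mathsf B}$ of $\ket\psi\bra\psi$. Then: (i) any quantum algorithm that, given only (black-box) query access to $U$ and $U^\dagger$, solves reality testing for every pure state $\ket\psi$ and every such state preparation unitary $U$ of $\ket\psi\bra\psi$ must make $\Omega(d^{1/4})$ queries; (ii) reality testing can be solved with a constant number of queries (two queries to $U$ and two to $U^*$ suffice) if query access to $U$ and its entrywise complex conjugate $U^*$ is given.
   Context: For a pure state $\ket\psi\in\mathbb{C}^d$ with amplitudes $\psi_i$, define $\mathrm{real}(\ket\psi)=|\langle\psi^*|\psi\rangle|^2=\big|\sum_{i=1}^d\psi_i^2\big|^2$, where $\ket{\psi^*}$ is the entrywise complex conjugate. Reality testing: given access to $\ket\psi$, decide with success probability at least $2/3$ whether $\mathrm{real}(\ket\psi)=1$ or $\mathrm{real}(\ket\psi)<1/10$ (promise: one of the two holds). A unitary $U\in(\mathbb{C}^{\hat d\times\hat d})_{\mathsf A}\otimes(\mathbb{C}^{d\times d})_{\mathsf B}$ is a state preparation unitary for a density matrix $\rho$ on $\mathbb{C}^d$ if $\mathrm{tr}_{\mathsf A}(U\ket0\bra0_{\mathsf{AB}}U^\dagger)=\rho_{\mathsf B}$. *)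

(* Defs.v *)
From mathcomp Require Import all_boot all_order all_algebra.
From mathcomp Require Import reals.
From mathcomp.real_closed Require Import complex mxtens.
Set Implicit Arguments. Unset Strict Implicit. Unset Printing Implicit Defensive.
Import Order.TTheory GRing.Theory Num.Theory.
Local Open Scope ring_scope.

Section Quantum.
Variable C : numClosedFieldType.

Definition conjmx m n (M : 'M[C]_(m, n)) : 'M[C]_(m, n) := map_mx Num.conj M.
Definition adjmx m n (M : 'M[C]_(m, n)) : 'M[C]_(n, m) := (conjmx M)^T.

Definition unitary n (U : 'M[C]_n) : Prop := U *m adjmx U = 1%:M.

Definition ket0 n : 'cV[C]_n := \col_i (if val i == 0%N then 1 else 0).

Definition pure_state d (psi : 'cV[C]_d) : Prop :=
  \sum_i `|psi i 0| ^+ 2 = 1.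

(* real(|psi>) = |<psi^*|psi>|^2 = |sum_i psi_i^2|^2 *)
Definition realness d (psi : 'cV[C]_d) : C := `| \sum_i psi i 0 ^+ 2 | ^+ 2.

(* partial trace over the first tensor factor A (dimension a) of an
   operator on A (x) B, with index (i,j) |-> mxtens_index (i, j) = i*b + j *)
Definition ptraceA a b (M : 'M[C]_(a * b)) : 'M[C]_b :=
  \matrix_(j, k) \sum_(i < a) M (mxtens_index (i, j)) (mxtens_index (i, k)).

Definition state_prep a b (U : 'M[C]_(a * b)) (rho : 'M[C]_b) : Prop :=
  unitary U /\ ptraceA (U *m ket0 (a * b) *m adjmx (U *m ket0 (a * b))) = rho.

Inductive qkind := QU | QUadj | QUconj | QUconjadj.

Definition qkind_eqb (k1 k2 : qkind) : bool :=
  match k1, k2 with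
  | QU, QU | QUadj, QUadj | QUconj, QUconj | QUconjadj, QUconjadj => true
  | _, _ => false
  end.

Definition oracle n (U : 'M[C]_n) (k : qkind) : 'M[C]_n :=
  match k with
  | QU => U
  | QUadj => adjmx U
  | QUconj => conjmx U
  | QUconjadj => adjmx (conjmx U)
  end.

(* A quantum query algorithm on a workspace C^w (x) C^n (the oracle acts on
   the second factor): it starts in |0>, applies V_0, then for each query
   j = 0..T-1 applies (1_w (x) O_j) followed by V_(j+1), and finally measures
   in the computational basis, accepting on the outcomes in [acc]. *)
Record qalgo (n : nat) := QAlgo {
  ws : nat;
  kinds : seq qkind;
  gates : nat -> 'M[C]_(ws * n);
  gates_unitary : forall i, unitary (gates i);
  acc : pred 'I_(ws * n)
}.

Fixpoint run_from n w (V : nat -> 'M[C]_(w * n)) (U : 'M[C]_n)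
    (ks : seq qkind) (i : nat) (v : 'cV[C]_(w * n)) : 'cV[C]_(w * n) :=
  match ks with
  | [::] => v
  | k :: ks' =>
      run_from V U ks' i.+1 (V i.+1 *m ((1%:M : 'M[C]_w) *t oracle U k) *m v)
  end.

Definition final_state n (A : qalgo n) (U : 'M[C]_n) : 'cV[C]_(ws A * n) :=
  run_from (gates A) U (kinds A) 0 (gates A 0 *m ket0 (ws A * n)).

Definition accept_prob n (A : qalgo n) (U : 'M[C]_n) : C :=
  \sum_(i | @acc n A i) `|final_state A U i 0| ^+ 2.

Definition num_queries n (A : qalgo n) : nat := size (kinds A).

Definition solves_reality_testing d (A : qalgo ((2 * d) * d)) : Prop :=
  forall (psi : 'cV[C]_d), pure_state psi ->
  forall (U : 'M[C]_((2 * d) * d)), state_prep U (psi *m adjmx psi) ->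
    (realness psi = 1 -> 2 / 3 <= accept_prob A U) /\
    (realness psi < 1 / 10 -> accept_prob A U <= 1 / 3).

End Quantum.

(* Main.v *)
(* (i) For psi with entries w_j x_j / sqrt d, x a sign vector, the reflection
   that exchanges |0> and |1>|psi> is a Hermitian state preparation unitary, so
   access to its adjoint is useless. If all w_j = 1 then psi is real, and if
   w_j = i for odd j then the realness of psi is at most 1/d^2. Purify a uniformly
   random x and view it in the Fourier basis of subsets S of the coordinates: a
   query adds elements to S or removes them, and after t queries |S| <= 2t. The
   two choices of w differ only in a phase when an element that is already in S is
   hit, which has squared amplitude O(t/d). A hybrid argument shows that T queries
   separate the two ensembles only if d = O(T^3), which is stronger than
   d = O(T^4).
   (ii) Two swap tests between the B registers of U|0> and U^*|0> both accept with
   probability ((1 + realness)/2)^2. *)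

Require Import Defs.
From mathcomp Require Import all_boot all_order all_algebra.
From mathcomp Require Import ring.
From mathcomp Require Import reals.
From mathcomp.real_closed Require Import complex mxtens.
Import Order.TTheory GRing.Theory Num.Theory.
Local Open Scope ring_scope.
Set Implicit Arguments.
Unset Strict Implicit.
Unset Printing Implicit Defensive.

(** * Adjoints, squared norms and families of isometries *)

Section HilbertSpace.
Variable C : numClosedFieldType.

Lemma adjmxE m n (A : 'M[C]_(m, n)) i j : adjmx A i j = (A j i)^*.
Proof. by rewrite !mxE. Qed.

Lemma adjmxK m n (A : 'M[C]_(m, n)) : adjmx (adjmx A) = A.
Proof. by apply/matrixP => i j; rewrite !adjmxE conjCK. Qed.

Lemma adjmxM m n p (A : 'M[C]_(m, n)) (B : 'M[C]_(n, p)) :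
  adjmx (A *m B) = adjmx B *m adjmx A.
Proof.
apply/matrixP => i j; rewrite !mxE rmorph_sum; apply: eq_bigr => k _.
by rewrite rmorphM mulrC !mxE.
Qed.

Lemma adjmxD m n (A B : 'M[C]_(m, n)) : adjmx (A + B) = adjmx A + adjmx B.
Proof. by apply/matrixP => i j; rewrite !mxE rmorphD. Qed.

Lemma adjmxB m n (A B : 'M[C]_(m, n)) : adjmx (A - B) = adjmx A - adjmx B.
Proof. by apply/matrixP => i j; rewrite !mxE rmorphB. Qed.

Lemma adjmxZ m n a (A : 'M[C]_(m, n)) : adjmx (a *: A) = a^* *: adjmx A.
Proof. by apply/matrixP => i j; rewrite !mxE rmorphM. Qed.

Lemma adjmx0 m n : adjmx (0 : 'M[C]_(m, n)) = 0.
Proof. by apply/matrixP => i j; rewrite !mxE conjC0. Qed.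

Lemma adjmx_sum m n (I : finType) (F : I -> 'M[C]_(m, n)) :
  adjmx (\sum_i F i) = \sum_i adjmx (F i).
Proof. exact: (big_morph _ (@adjmxD m n) (@adjmx0 m n)). Qed.

Lemma adjmx1 n : adjmx (1%:M : 'M[C]_n) = 1%:M.
Proof. by apply/matrixP => i j; rewrite !mxE rmorph_nat eq_sym. Qed.

Lemma adjmx_tens m n p q (A : 'M[C]_(m, n)) (B : 'M[C]_(p, q)) :
  adjmx (A *t B) = adjmx A *t adjmx B.
Proof. by apply/matrixP => i j; rewrite !mxE rmorphM. Qed.

Lemma conj_mulmx m n p (A : 'M[C]_(m, n)) (B : 'M[C]_(n, p)) :
  Defs.conjmx (A *m B) = Defs.conjmx A *m Defs.conjmx B.
Proof.
apply/matrixP => i j; rewrite !mxE rmorph_sum; apply: eq_bigr => k _.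
by rewrite rmorphM !mxE.
Qed.

Lemma unitary_adjmulmx n (U : 'M[C]_n) : unitary U -> adjmx U *m U = 1%:M.
Proof. exact: mulmx1C. Qed.

Lemma unitaryM n (U V : 'M[C]_n) : unitary U -> unitary V -> unitary (U *m V).
Proof.
move=> hU hV; rewrite /unitary adjmxM mulmxA -[U *m V *m _]mulmxA.
by rewrite [V *m _]hV mulmx1.
Qed.

Lemma unitary1 n : unitary (1%:M : 'M[C]_n).
Proof. by rewrite /unitary adjmx1 mulmx1. Qed.

Definition sqn m (v : 'cV[C]_m) : C := \sum_i `|v i 0| ^+ 2.

Lemma sqnE m (v : 'cV[C]_m) : sqn v = (adjmx v *m v) 0 0.
Proof. by rewrite mxE; apply: eq_bigr => i _; rewrite adjmxE normCK mulrC. Qed.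

Lemma sqn_ge0 m (v : 'cV[C]_m) : 0 <= sqn v.
Proof. by apply: sumr_ge0 => i _; rewrite exprn_ge0. Qed.

Lemma sqn0 m : sqn (0 : 'cV[C]_m) = 0.
Proof. by rewrite /sqn big1 // => i _; rewrite mxE normr0 expr0n. Qed.

Lemma sqnZ m a (v : 'cV[C]_m) : sqn (a *: v) = `|a| ^+ 2 * sqn v.
Proof.
by rewrite /sqn mulr_sumr; apply: eq_bigr => i _; rewrite mxE normrM exprMn.
Qed.

Lemma sqnN m (v : 'cV[C]_m) : sqn (- v) = sqn v.
Proof. by apply: eq_bigr => i _; rewrite mxE normrN. Qed.

Lemma sqn_scaled_isometry m p (a : C) (A : 'M[C]_(p, m)) (v : 'cV[C]_m) :
  adjmx A *m A = a%:M -> sqn (A *m v) = a * sqn v.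
Proof.
move=> hA; rewrite !sqnE adjmxM mulmxA -[_ *m adjmx A *m A]mulmxA hA.
by rewrite scalar_mxC -mulmxA mul_scalar_mx mxE.
Qed.

Lemma sqn_unitary n (U : 'M[C]_n) v : unitary U -> sqn (U *m v) = sqn v.
Proof.
by move=> hU; rewrite (sqn_scaled_isometry (a := 1)) ?mul1r // unitary_adjmulmx.
Qed.

(** After the triangle inequality, the two sides differ by a^-1 (a|x| - |y|)^2. The free weight [a]
    is what later keeps the hybrid argument free of square roots. *)
Lemma sqrD_le (a x y : C) : 0 < a ->
  `|x + y| ^+ 2 <= (1 + a) * `|x| ^+ 2 + (1 + a^-1) * `|y| ^+ 2.
Proof.
move=> a0; have ane : a != 0 by rewrite gt_eqF.
apply: (@le_trans _ _ ((`|x| + `|y|) ^+ 2)).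
  by rewrite ler_pXn2r ?nnegrE ?addr_ge0 // ler_normD.
rewrite -subr_ge0.
have -> : (1 + a) * `|x| ^+ 2 + (1 + a^-1) * `|y| ^+ 2 - (`|x| + `|y|) ^+ 2
  = a^-1 * (a * `|x| - `|y|) ^+ 2 by field.
apply: mulr_ge0; first by rewrite invr_ge0 ltW.
apply: real_exprn_even_ge0 => //.
by rewrite rpredB ?rpredM ?normr_real ?gtr0_real.
Qed.

Lemma sqnD_le m (a : C) (u v : 'cV[C]_m) : 0 < a ->
  sqn (u + v) <= (1 + a) * sqn u + (1 + a^-1) * sqn v.
Proof.
move=> a0; rewrite /sqn !mulr_sumr -big_split /=.
by apply: ler_sum => i _; rewrite mxE; apply: sqrD_le.
Qed.

(** Cauchy-Schwarz: both sides become double sums over [A], compared termwise by |F i||F j| <= (|F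
    i|^2 + |F j|^2)/2. *)
Lemma sqr_sum_le (I : finType) (A : {set I}) (F : I -> C) :
  `|\sum_(i in A) F i| ^+ 2 <= #|A|%:R * \sum_(i in A) `|F i| ^+ 2.
Proof.
have -> : #|A|%:R * (\sum_(i in A) `|F i| ^+ 2) =
   2^-1 * \sum_(i in A) \sum_(j in A) (`|F i| ^+ 2 + `|F j| ^+ 2).
  under [in RHS]eq_bigr => i _.
    rewrite big_split /= sumr_const.
    over.
  rewrite big_split /= sumr_const sumrMnl -mulr2n -[X in _ = 2^-1 * X]mulr_natl.
  by rewrite mulrA mulVf ?pnatr_eq0 // mul1r mulr_natl.
apply: (@le_trans _ _ ((\sum_(i in A) `|F i|) ^+ 2)).
  by rewrite ler_pXn2r ?nnegrE ?sumr_ge0 // ler_norm_sum.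
rewrite expr2 mulr_suml mulr_sumr; apply: ler_sum => i _.
rewrite !mulr_sumr; apply: ler_sum => j _.
rewrite -subr_ge0.
have -> : 2^-1 * (`|F i| ^+ 2 + `|F j| ^+ 2) - `|F i| * `|F j| =
   2^-1 * (`|F i| - `|F j|) ^+ 2 by field.
apply: mulr_ge0; first by rewrite invr_ge0 ler0n.
by apply: real_exprn_even_ge0 => //; rewrite rpredB ?normr_real.
Qed.

Lemma sqn_sum_le m (I : finType) (A : {set I}) (F : I -> 'cV[C]_m) :
  sqn (\sum_(i in A) F i) <= #|A|%:R * \sum_(i in A) sqn (F i).
Proof.
rewrite /sqn exchange_big /= mulr_sumr; apply: ler_sum => k _.
by rewrite summxE; apply: sqr_sum_le.
Qed.

Section OrthogonalIsometries.
Variables (I : finType) (N M : nat) (E : I -> 'M[C]_(N, M)).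
Hypothesis EE : forall j k, adjmx (E j) *m E k = (j == k)%:R%:M.

Lemma sqn_sum_isometry (v : I -> 'cV[C]_M) :
  sqn (\sum_j E j *m v j) = \sum_j sqn (v j).
Proof.
rewrite sqnE adjmx_sum mulmx_suml summxE; apply: eq_bigr => j _.
rewrite adjmxM mulmx_sumr (bigD1 j) //= big1 ?addr0.
  by rewrite mulmxA -[_ *m E j]mulmxA EE eqxx mulmx1 -sqnE.
move=> k kj; rewrite mulmxA -[_ *m E k]mulmxA EE eq_sym (negPf kj).
by rewrite raddf0 mulmx0 mul0mx.
Qed.

(** Here [p] is the orthogonal projection of [v] onto the sum of the ranges of the [E j]. The left
    side is the squared norm of [p], and Pythagoras applies to p + (v - p). *)
Lemma bessel (v : 'cV[C]_N) : \sum_j sqn (adjmx (E j) *m v) <= sqn v.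
Proof.
pose w j := adjmx (E j) *m v; pose p := \sum_j E j *m w j.
have Ep j : adjmx (E j) *m p = w j.
  rewrite mulmx_sumr (bigD1 j) //= big1 ?addr0.
    by rewrite mulmxA EE eqxx mul1mx.
  by move=> k kj; rewrite mulmxA EE eq_sym (negPf kj) raddf0 mul0mx.
have pr u : (forall j, adjmx (E j) *m u = 0) -> adjmx p *m u = 0.
  move=> hu; rewrite adjmx_sum mulmx_suml big1 // => j _.
  by rewrite adjmxM -mulmxA hu mulmx0.
have pvp : adjmx p *m (v - p) = 0 by apply: pr => j; rewrite mulmxBr Ep subrr.
have -> : \sum_j sqn (w j) = sqn p by rewrite sqn_sum_isometry.
suff -> : sqn v = sqn p + sqn (v - p) by rewrite lerDl sqn_ge0.
have {1}-> : v = p + (v - p) by rewrite addrC subrK.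
move: (v - p) pvp => r pr0; rewrite !sqnE adjmxD mulmxDl !mulmxDr pr0 addr0.
have -> : adjmx r *m p = 0 by rewrite -[LHS]adjmxK adjmxM adjmxK pr0 adjmx0.
by rewrite add0r [LHS]mxE.
Qed.

End OrthogonalIsometries.

(** With this normalisation, half of q times its adjoint is a projection, so the matrix is a
    reflection. *)
Lemma householder_unitary N M (q : 'M[C]_(N, M)) :
  adjmx q *m q = 2%:M -> unitary (1%:M - q *m adjmx q).
Proof.
move=> hq; rewrite /unitary adjmxB adjmx1 adjmxM adjmxK.
set Q := q *m _; have QQ : Q *m Q = Q + Q.
  rewrite /Q mulmxA -[q *m _ *m q]mulmxA hq mul_mx_scalar -scalemxAl.
  by rewrite scaler_nat mulr2n.
by rewrite mulmxBr mulmx1 mulmxBl mul1mx QQ opprB addrK subrK.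
Qed.

End HilbertSpace.

(** * Fourier analysis on sign vectors, twisted by a phase pattern *)

Section SignFourier.
Variables (C : numClosedFieldType) (d : nat).
Implicit Types (S x : {set 'I_d}) (j : 'I_d).

(** Symmetric difference with {j}. *)
Definition tog j S : {set 'I_d} := [set k | (k \in S) (+) (k == j)].

Lemma in_tog j S k : (k \in tog j S) = (k \in S) (+) (k == j).
Proof. by rewrite inE. Qed.

Lemma mem_tog j S : (j \in tog j S) = (j \notin S).
Proof. by rewrite in_tog eqxx addbT. Qed.

Lemma togK j : involutive (tog j).
Proof. by move=> S; apply/setP => k; rewrite !in_tog -addbA addbb addbF. Qed.

Lemma tog_in j S : j \in S -> tog j S = S :\ j.
Proof.
move=> jS; apply/setP => k; rewrite in_tog !inE.
by case: eqP => [->|_]; rewrite ?jS ?addbF.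
Qed.

Lemma tog_notin j S : j \notin S -> tog j S = j |: S.
Proof.
move=> jS; apply/setP => k; rewrite in_tog !inE.
by case: eqP => [->|_]; rewrite ?(negPf jS) ?addbF.
Qed.

Lemma card_tog j S : (#|tog j S| <= #|S|.+1)%N.
Proof.
have [jS|jS] := boolP (j \in S).
  by rewrite tog_in // (leq_trans (subset_leq_card (subD1set S j))).
by rewrite tog_notin // cardsU1 jS.
Qed.

(* A set x encodes the sign vector with entries -1 exactly on x; the predicate
   b selects the coordinates that are multiplied by 'i. *)
Variable b : pred 'I_d.

Definition phase x j : C := (if b j then 'i else 1) * (-1) ^+ (j \in x).
Definition eta j : C := if b j then -1 else 1.
Definition wt x S : C := \prod_(j in S) phase x j.

Lemma norm_phase x j : `|phase x j| = 1.
Proof.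
rewrite normrM normrX normrN1 expr1n mulr1.
by case: (b j); rewrite ?normCi ?normr1.
Qed.

Lemma phase_conjM x j : phase x j * (phase x j)^* = 1.
Proof. by rewrite -normCK norm_phase expr1n. Qed.

Lemma phase_sqr x j : phase x j ^+ 2 = eta j.
Proof.
rewrite exprMn -exprM mulnC exprM sqrrN expr1n expr1n mulr1 /eta.
by case: (b j); rewrite ?sqrCi ?expr1n.
Qed.

Lemma conj_phase x j : (phase x j)^* = eta j * phase x j.
Proof.
have ee : eta j * eta j = 1 by rewrite /eta; case: (b j); rewrite ?mulrNN mulr1.
have := phase_conjM x j; have := phase_sqr x j; move: (phase x j) => p pp pq.
by rewrite -[LHS]mulr1 -ee -{1}pp expr2 !mulrA [_^* * _]mulrC pq mul1r mulrC.
Qed.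

Lemma norm_wt x S : `|wt x S| = 1.
Proof. by rewrite normr_prod big1 // => j _; rewrite norm_phase. Qed.

(** Removing [j] divides by a unit phase, that is, multiplies by its conjugate. *)
Lemma wt_tog x j S :
  wt x (tog j S) = (if j \in S then (phase x j)^* else phase x j) * wt x S.
Proof.
have [jS|jS] := boolP (j \in S).
  rewrite tog_in // /wt [in RHS](big_setD1 j) //=.
  move: (phase x j) (phase_conjM x j) => p pq; rewrite mulrA.
  by rewrite [_^* * _]mulrC pq mul1r.
by rewrite tog_notin // /wt big_setU1.
Qed.

Lemma wt_tog_sign x j S : wt (tog j x) S = (-1) ^+ (j \in S) * wt x S.
Proof.
have e k : phase (tog j x) k = (-1) ^+ (k == j) * phase x k.
  rewrite /phase in_tog mulrCA; congr (_ * _).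
  by case: (k \in x); case: (k == j); rewrite ?expr0 ?expr1 ?mulr1 ?mulrNN ?mul1r.
have e' k : k != j -> phase (tog j x) k = phase x k.
  by move=> kj; rewrite e (negPf kj) mul1r.
have [jS|jS] := boolP (j \in S).
  rewrite /wt (big_setD1 j) //= [in RHS](big_setD1 j) //= e eqxx -[LHS]mulrA.
  congr (_ * (_ * _)); apply: eq_bigr => k; rewrite !inE => /andP[kj _].
  exact: e'.
rewrite mul1r; apply: eq_bigr => k kS; apply: e'.
by apply: contraNneq jS => <-.
Qed.

(** If the sets differ, pick [j] in exactly one of them. Toggling [j] in [x] permutes the summands
    and negates each, so the sum equals its own negative. *)
Lemma wt_orthogonal S S' :
  \sum_x wt x S * (wt x S')^* = (2 ^ d)%:R * (S == S')%:R.
Proof.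
have [<-|ne] := eqVneq S S'.
  rewrite (eq_bigr (fun=> 1)) => [|x _].
    by rewrite sumr_const mulr1 -cardsT -powersetT card_powerset cardsT card_ord.
  by rewrite -normCK norm_wt expr1n.
have [j jSS] : exists j, (j \in S) (+) (j \in S').
  apply/existsP; apply: contraNT ne; rewrite negb_exists => /forallP h.
  by apply/eqP/setP => k; move: (h k); case: (k \in S); case: (k \in S').
rewrite mulr0; set s := (X in X = 0).
suff e : s = - s.
  have /eqP : s *+ 2 = 0 by rewrite mulr2n {2}e subrr.
  by rewrite mulrn_eq0 => /eqP.
rewrite {1}/s (reindex_inj (inv_inj (@togK j))) /= -sumrN; apply: eq_bigr => x _.
rewrite !wt_tog_sign rmorphM mulrACA rmorphXn rmorphN rmorph1 /= -signr_addb jSS.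
by rewrite expr1 mulN1r.
Qed.

Lemma scalar_parseval (g : {set 'I_d} -> C) :
  \sum_x `|\sum_S wt x S * g S| ^+ 2 = (2 ^ d)%:R * \sum_S `|g S| ^+ 2.
Proof.
transitivity (\sum_S \sum_S' g S * (g S')^* * \sum_x wt x S * (wt x S')^*).
  under eq_bigr => x _.
    rewrite normCK rmorph_sum mulr_suml.
    under eq_bigr => S _.
      rewrite mulr_sumr.
      over.
    over.
  rewrite exchange_big; apply: eq_bigr => S _ /=.
  rewrite exchange_big; apply: eq_bigr => S' _ /=.
  rewrite mulr_sumr; apply: eq_bigr => x _.
  by rewrite rmorphM mulrACA mulrC.
rewrite mulr_sumr; apply: eq_bigr => S _.
rewrite (bigD1 S) //= [X in _ + X]big1 ?addr0 => [|S' S'S].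
  by rewrite wt_orthogonal eqxx mulr1 -normCK mulrC.
by rewrite wt_orthogonal eq_sym (negPf S'S) mulr0 mulr0.
Qed.

Section Vectors.
Variable m : nat.
Implicit Type f : {set 'I_d} -> 'cV[C]_m.

Definition fnorm f : C := \sum_S sqn (f S).
(** Fourier synthesis at the sign vector [x] from vector-valued coefficients [f]. For a purified run
    this is the state of the algorithm on the instance [x]. *)
Definition ev x f : 'cV[C]_m := \sum_S wt x S *: f S.

Lemma parseval (P : pred 'I_m) f :
  \sum_x \sum_(i | P i) `|ev x f i 0| ^+ 2 =
  (2 ^ d)%:R * \sum_S \sum_(i | P i) `|f S i 0| ^+ 2.
Proof.
rewrite exchange_big [in RHS]exchange_big /= mulr_sumr; apply: eq_bigr => i _.
rewrite -scalar_parseval; apply: eq_bigr => x _; rewrite summxE.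
by congr (`|_| ^+ 2); apply: eq_bigr => S _; rewrite mxE.
Qed.

Lemma sum_sqn_ev f : \sum_x sqn (ev x f) = (2 ^ d)%:R * fnorm f.
Proof. exact: parseval. Qed.

Lemma evB x f g : ev x (fun S => f S - g S) = ev x f - ev x g.
Proof. by rewrite -sumrB; apply: eq_bigr => S _; rewrite scalerBr. Qed.

End Vectors.

Lemma ev_mulmx m p x (A : 'M[C]_(p, m)) f :
  ev x (fun S => A *m f S) = A *m ev x f.
Proof. by rewrite mulmx_sumr; apply: eq_bigr => S _; rewrite scalemxAr. Qed.

(** Multiplication by a phase at [x] becomes a toggle of [j] on the coefficients; [c] makes the
    factor the same whether the toggle adds or removes [j]. *)
Lemma ev_tog m p x j (c : {set 'I_d} -> C) a (A : 'M[C]_(p, m)) f :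
  (forall S, wt x (tog j S) * c (tog j S) = a * wt x S) ->
  ev x (fun S => c S *: (A *m f (tog j S))) = a *: (A *m ev x f).
Proof.
move=> hc; rewrite /ev (reindex_inj (inv_inj (@togK j))) /= mulmx_sumr scaler_sumr.
by apply: eq_bigr => S _; rewrite togK scalerA hc -scalemxAr scalerA.
Qed.

Lemma ev_sum m (I : finType) x (F : I -> {set 'I_d} -> 'cV[C]_m) :
  ev x (fun S => \sum_i F i S) = \sum_i ev x (F i).
Proof. by rewrite exchange_big; apply: eq_bigr => S _; rewrite scaler_sumr. Qed.

Lemma evZ m x a (f : {set 'I_d} -> 'cV[C]_m) :
  ev x (fun S => a *: f S) = a *: ev x f.
Proof.
by rewrite scaler_sumr; apply: eq_bigr => S _; rewrite !scalerA mulrC.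
Qed.

(** By Parseval, norm identities for operators on coefficients reduce to matrix identities at each
    [x]. *)
Lemma fnorm_ev m p (a : C) (f : {set 'I_d} -> 'cV[C]_m)
    (g : {set 'I_d} -> 'cV[C]_p) :
  (forall x, sqn (ev x f) = a * sqn (ev x g)) -> fnorm f = a * fnorm g.
Proof.
move=> h; have ne0 : (2 ^ d)%:R != 0 :> C by rewrite pnatr_eq0 expn_eq0.
apply: (mulfI ne0); rewrite mulrCA -!sum_sqn_ev mulr_sumr.
by apply: eq_bigr => x _.
Qed.

End SignFourier.

(** * The reflection oracles and their action on the Fourier register *)

Section Purification.
Variables (C : numClosedFieldType) (d N M : nat).
Variables (B0 : 'M[C]_(N, M)) (E : 'I_d -> 'M[C]_(N, M)) (s : C).
Hypothesis d_gt0 : (0 < d)%N.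
Hypothesis B0B0 : adjmx B0 *m B0 = 1%:M.
Hypothesis B0E : forall j, adjmx B0 *m E j = 0.
Hypothesis EE : forall j k, adjmx (E j) *m E k = (j == k)%:R%:M.
Hypothesis s_real : s^* = s.
Hypothesis s_sqr : s ^+ 2 = d%:R^-1.
Implicit Types (b : pred 'I_d) (x S : {set 'I_d}).

Definition qvec b x : 'M[C]_(N, M) := B0 - s *: \sum_j phase C b x j *: E j.
Definition refl b x : 'M[C]_N := 1%:M - qvec b x *m adjmx (qvec b x).

(** The two parts are orthogonal and each contributes 1, the second because d unit phases are
    weighted by s^2 = 1/d. *)
Lemma qvec_isometry b x : adjmx (qvec b x) *m qvec b x = 2%:M.
Proof.
rewrite /qvec; set K := \sum_j _; have B0K : adjmx B0 *m K = 0.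
  by rewrite mulmx_sumr big1 // => j _; rewrite -scalemxAr B0E scaler0.
have KB0 : adjmx K *m B0 = 0 by rewrite -[LHS]adjmxK adjmxM adjmxK B0K adjmx0.
have KK : adjmx K *m K = d%:R%:M.
  rewrite adjmx_sum mulmx_suml.
  under eq_bigr => j _.
    rewrite mulmx_sumr (bigD1 j) //= big1 ?addr0; last first.
      move=> k kj; rewrite -scalemxAr adjmxZ -scalemxAl EE eq_sym (negPf kj).
      by rewrite raddf0 !scaler0.
    rewrite -scalemxAr adjmxZ -scalemxAl EE eqxx scalerA phase_conjM scale1r.
    over.
  by rewrite sumr_const card_ord -raddfMn.
rewrite adjmxB adjmxZ mulmxBr !mulmxBl B0B0 -!scalemxAl -!scalemxAr B0K KB0 KK.
rewrite !scaler0 subr0 sub0r opprK scalerA s_real -expr2 s_sqr.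
by rewrite scale_scalar_mx mulVf ?pnatr_eq0 -?lt0n // -raddfD.
Qed.

Lemma refl_unitary b x : unitary (refl b x).
Proof. exact/householder_unitary/qvec_isometry. Qed.

(* The sign vector x is replaced by a register holding a superposition of the
   Fourier characters S, on which the j-th sign acts by toggling j. After a
   diagonal change of basis, b enters only when qop removes j from the register
   or, dually, when qadj adds it. *)
Definition qop b (f : {set 'I_d} -> 'cV[C]_M) S : 'cV[C]_N :=
  B0 *m f S -
  s *: \sum_j (if j \in S then 1 else eta C b j) *: (E j *m f (tog j S)).

Definition qadj b (f : {set 'I_d} -> 'cV[C]_N) S : 'cV[C]_M :=
  adjmx B0 *m f S -
  s *: \sum_j (if j \in S then eta C b j else 1) *: (adjmx (E j) *m f (tog j S)).

Definition Uop b (f : {set 'I_d} -> 'cV[C]_N) S : 'cV[C]_N :=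
  f S - qop b (qadj b f) S.

Lemma eta_sqr b j : eta C b j * eta C b j = 1.
Proof. by rewrite /eta; case: (b j); rewrite ?mulrNN mulr1. Qed.

Lemma ev_qop b x f : ev b x (qop b f) = qvec b x *m ev b x f.
Proof.
rewrite evB ev_mulmx evZ ev_sum mulmxBl -scalemxAl mulmx_suml.
congr (_ - _ *: _); apply: eq_bigr => j _.
rewrite -scalemxAl; pose c S := if j \in S then 1 else eta C b j.
(* A toggle that removes [j] yields the conjugate phase, which is [eta] times the phase; the [eta]
   in [c] cancels this sign. *)
apply: (ev_tog (c := c)) => S; rewrite /c mem_tog wt_tog conj_phase.
by case: (j \in S); rewrite /= ?mulr1 // mulrC !mulrA eta_sqr mul1r.
Qed.

Lemma ev_qadj b x f : ev b x (qadj b f) = adjmx (qvec b x) *m ev b x f.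
Proof.
rewrite evB ev_mulmx evZ ev_sum adjmxB adjmxZ adjmx_sum mulmxBl -scalemxAl.
rewrite mulmx_suml s_real; congr (_ - _ *: _); apply: eq_bigr => j _.
rewrite adjmxZ -scalemxAl; pose c S := if j \in S then eta C b j else 1.
apply: (ev_tog (c := c)) => S; rewrite /c mem_tog wt_tog conj_phase.
by case: (j \in S); rewrite /= ?mulr1 // mulrC !mulrA.
Qed.

Lemma ev_Uop b x f : ev b x (Uop b f) = refl b x *m ev b x f.
Proof. by rewrite evB ev_qop ev_qadj mulmxA [RHS]mulmxBl mul1mx. Qed.

Lemma fnorm_Uop b f : fnorm (Uop b f) = fnorm f.
Proof.
rewrite -[RHS]mul1r; apply: (@fnorm_ev _ _ b) => x.
by rewrite ev_Uop mul1r sqn_unitary //; apply: refl_unitary.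
Qed.

Lemma fnorm_qop b f : fnorm (qop b f) = 2 * fnorm f.
Proof.
apply: (@fnorm_ev _ _ b) => x; rewrite ev_qop.
exact/sqn_scaled_isometry/qvec_isometry.
Qed.

Lemma eq_fnorm m (f g : {set 'I_d} -> 'cV[C]_m) : f =1 g -> fnorm f = fnorm g.
Proof. by move=> fg; apply: eq_bigr => S _; rewrite fg. Qed.

Lemma fnormD_le m (a : C) (f g : {set 'I_d} -> 'cV[C]_m) : 0 < a ->
  fnorm (fun S => f S + g S) <= (1 + a) * fnorm f + (1 + a^-1) * fnorm g.
Proof.
move=> a0; rewrite /fnorm !mulr_sumr -big_split /=; apply: ler_sum => S _.
exact: sqnD_le.
Qed.

Lemma fnormD2_le m (f g : {set 'I_d} -> 'cV[C]_m) :
  fnorm (fun S => f S + g S) <= 2 * fnorm f + 2 * fnorm g.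
Proof. by have := fnormD_le f g (@ltr01 C); rewrite invr1. Qed.

Lemma fnormN m (f : {set 'I_d} -> 'cV[C]_m) : fnorm (fun S => - f S) = fnorm f.
Proof. by apply: eq_bigr => S _; rewrite sqnN. Qed.

(** Since [qop] doubles [fnorm], it suffices to bound [qop b (qadj b f)]. This is [f] minus
    [Uop b f], two families of equal [fnorm], hence at most 4 times that of [f]. *)
Lemma fnorm_qadj b f : fnorm (qadj b f) <= 2 * fnorm f.
Proof.
have two0 : 0 < 2 :> C by rewrite ltr0n.
rewrite -(ler_pM2l two0) -(fnorm_qop b).
have -> : fnorm (qop b (qadj b f)) = fnorm (fun S => f S + - Uop b f S).
  by apply: eq_fnorm => S; rewrite /Uop opprB addrC subrK.
by apply: le_trans (fnormD2_le _ _) _; 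
  rewrite fnormN fnorm_Uop -mulr2n -[_ *+ 2]mulr_natl.
Qed.

Lemma qopB b f g S : qop b (fun S => f S - g S) S = qop b f S - qop b g S.
Proof.
rewrite /qop mulmxBr; set y := \sum_j _; set y1 := \sum_j _; set y2 := \sum_j _.
have -> : y = y1 - y2.
  by rewrite -sumrB; apply: eq_bigr => j _; rewrite mulmxBr scalerBr.
by rewrite scalerBr !opprB addrACA [RHS]addrACA; congr (_ + _); rewrite addrC.
Qed.

Lemma qadjB b f g S : qadj b (fun S => f S - g S) S = qadj b f S - qadj b g S.
Proof.
rewrite /qadj mulmxBr; set y := \sum_j _; set y1 := \sum_j _; set y2 := \sum_j _.
have -> : y = y1 - y2.
  by rewrite -sumrB; apply: eq_bigr => j _; rewrite mulmxBr scalerBr.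
by rewrite scalerBr !opprB addrACA [RHS]addrACA; congr (_ + _); rewrite addrC.
Qed.

Definition deg_le m t (f : {set 'I_d} -> 'cV[C]_m) :=
  forall S, (t < #|S|)%N -> f S = 0.

Lemma card_tog_gt t j S : (t.+1 < #|S|)%N -> (t < #|tog j S|)%N.
Proof. by move=> h; have := card_tog j (tog j S); rewrite togK => /(leq_trans h). Qed.

Lemma deg_le_qop b t f : deg_le t f -> deg_le t.+1 (qop b f).
Proof.
move=> hf S hS; rewrite /qop hf ?(ltnW hS) // mulmx0 big1 ?scaler0 ?subr0 // => j _.
by rewrite hf ?mulmx0 ?scaler0 // card_tog_gt.
Qed.

Lemma deg_le_qadj b t f : deg_le t f -> deg_le t.+1 (qadj b f).
Proof.
move=> hf S hS; rewrite /qadj hf ?(ltnW hS) // mulmx0 big1 ?scaler0 ?subr0 // => j _.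
by rewrite hf ?mulmx0 ?scaler0 // card_tog_gt.
Qed.

Lemma deg_le_Uop b t f : deg_le t f -> deg_le t.+2 (Uop b f).
Proof.
move=> hf S hS; rewrite /Uop (deg_le_qop b (deg_le_qadj b hf)) // subr0 hf //.
exact: ltnW (ltnW hS).
Qed.

Lemma norm_eta_le b j : `|1 - eta C b j| ^+ 2 <= 4.
Proof.
rewrite /eta; case: (b j); last by rewrite subrr normr0 expr0n ler0n.
by rewrite opprK -[1 + 1]/(2%:R) normr_nat -natrX.
Qed.

Lemma norm_s_sqr : `|s| ^+ 2 = d%:R^-1.
Proof. by rewrite normCK s_real -expr2. Qed.

(** For fixed [j], the toggle is a bijection from the sets avoiding [j] to those containing it. *)
Lemma sum_tog_in (g : 'I_d -> {set 'I_d} -> C) :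
  \sum_(S : {set 'I_d}) \sum_(j | j \notin S) g j (tog j S) =
  \sum_(S : {set 'I_d}) \sum_(j in S) g j S.
Proof.
rewrite (exchange_big_dep predT) //= [RHS](exchange_big_dep predT) //=.
apply: eq_bigr => j _; rewrite (reindex_inj (inv_inj (@togK _ j))) /=.
by apply: eq_big => S; rewrite ?mem_tog ?negbK // togK.
Qed.

Lemma sum_tog_notin (g : 'I_d -> {set 'I_d} -> C) :
  \sum_(S : {set 'I_d}) \sum_(j in S) g j (tog j S) =
  \sum_(S : {set 'I_d}) \sum_(j | j \notin S) g j S.
Proof.
rewrite (exchange_big_dep predT) //= [RHS](exchange_big_dep predT) //=.
apply: eq_bigr => j _; rewrite (reindex_inj (inv_inj (@togK _ j))) /=.
by apply: eq_big => S; rewrite ?mem_tog // togK.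
Qed.

(** The operators differ only where [j] is removed. The ranges of the [E j] are orthogonal, so
    squared norms add, and each [f S] is charged once per element of [S], at most t times, with
    weight 4/d. *)
Lemma fnorm_qop_diff b t f : deg_le t f ->
  fnorm (fun S => qop b f S - qop pred0 f S) <= d%:R^-1 * (4 * t)%:R * fnorm f.
Proof.
move=> hf; pose g (j : 'I_d) (S : {set 'I_d}) := (4 : C) * sqn (f S).
have sqE S : sqn (qop b f S - qop pred0 f S) <=
    d%:R^-1 * \sum_(j | j \notin S) g j (tog j S).
  have -> : qop b f S - qop pred0 f S =
     s *: \sum_j E j *m ((if j \in S then 0 else 1 - eta C b j) *: f (tog j S)).
    rewrite /qop opprB addrC addrA subrK -scalerBr -sumrB; congr (_ *: _).
    apply: eq_bigr => j _; rewrite -scalemxAr -scalerBl; congr (_ *: _).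
    by rewrite /eta /=; case: (j \in S); rewrite ?subrr.
  rewrite sqnZ norm_s_sqr sqn_sum_isometry // ler_wpM2l ?invr_ge0 ?ler0n //.
  rewrite [leRHS]big_mkcond /=; apply: ler_sum => j _.
  case: (j \in S) => /=; first by rewrite scale0r sqn0.
  by rewrite sqnZ ler_wpM2r ?sqn_ge0 // norm_eta_le.
apply: le_trans (ler_sum _ (fun S _ => sqE S)) _.
rewrite -mulr_sumr sum_tog_in -mulrA ler_wpM2l ?invr_ge0 ?ler0n //.
rewrite mulr_sumr; apply: ler_sum => S _.
rewrite sumr_const -[leLHS]mulr_natl mulrA -natrM mulnC.
have [tS|tS] := ltnP t #|S|; first by rewrite hf // sqn0 !mulr0.
by rewrite ler_wpM2r ?sqn_ge0 // ler_nat leq_mul2l.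
Qed.

(** Now the terms for different [j] land in the same space. Cauchy-Schwarz over the at most t+1
    elements of the output set costs the factor t+1, and Bessel's inequality then sums the
    components of each [f S] over [j]. *)
Lemma fnorm_qadj_diff b t f : deg_le t f ->
  fnorm (fun S => qadj b f S - qadj pred0 f S) <=
  d%:R^-1 * (4 * t.+1)%:R * fnorm f.
Proof.
move=> hf; pose g (j : 'I_d) (S : {set 'I_d}) := (4 * t.+1)%:R * sqn (adjmx (E j) *m f S).
have sqE S : sqn (qadj b f S - qadj pred0 f S) <=
    d%:R^-1 * \sum_(j in S) g j (tog j S).
  have -> : qadj b f S - qadj pred0 f S =
     s *: \sum_(j in S) (1 - eta C b j) *: (adjmx (E j) *m f (tog j S)).
    rewrite /qadj opprB addrC addrA subrK -scalerBr -sumrB; congr (_ *: _).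
    rewrite [RHS]big_mkcond /=.
    apply: eq_bigr => j _; rewrite -scalerBl.
    by rewrite /eta /=; case: (j \in S); rewrite ?subrr ?scale0r.
  rewrite sqnZ norm_s_sqr ler_wpM2l ?invr_ge0 ?ler0n //.
  (* On larger sets every term vanishes by the degree bound, so Cauchy-Schwarz is needed only for
     |S| <= t+1. *)
  have [tS|tS] := ltnP t.+1 #|S|.
    rewrite big1 ?sqn0 => [|j _].
      by apply: sumr_ge0 => j _; rewrite mulr_ge0 ?ler0n ?sqn_ge0.
    by rewrite hf ?mulmx0 ?scaler0 // card_tog_gt.
  apply: le_trans (sqn_sum_le _ _) _; rewrite mulr_sumr.
  apply: ler_sum => j jS; rewrite sqnZ mulrA ler_wpM2r ?sqn_ge0 //.
  by rewrite mulnC natrM ler_pM ?ler0n ?exprn_ge0 ?norm_eta_le ?ler_nat.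
apply: le_trans (ler_sum _ (fun S _ => sqE S)) _.
rewrite -mulr_sumr sum_tog_notin -mulrA ler_wpM2l ?invr_ge0 ?ler0n //.
rewrite mulr_sumr; apply: ler_sum => S _; rewrite -mulr_sumr ler_wpM2l ?ler0n //.
apply: le_trans (bessel EE (f S)).
by rewrite big_mkcond /=; apply: ler_sum => j _; case: ifP => // _; apply: sqn_ge0.
Qed.

Lemma subrBB (Z : zmodType) (a p q : Z) : a - p - (a - q) = q - p.
Proof. by rewrite opprB addrC addrA subrK. Qed.

Lemma subr_trans (Z : zmodType) (p q r : Z) : p - q = r - q + (p - r).
Proof. by rewrite [RHS]addrC addrA subrK. Qed.

Lemma subr_interchange (Z : zmodType) (p q r t : Z) :
  p - q - (r - t) = p - r - (q - t).
Proof. by rewrite !opprB addrACA [RHS]addrACA [- q - r]addrC. Qed.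

(** Telescope the difference of the products [qop] after [qadj], so that only one factor changes in
    each of two terms. *)
Lemma fnorm_Uop_diff b t f : deg_le t f ->
  fnorm (fun S => Uop b f S - Uop pred0 f S) <= d%:R^-1 * (32 * t.+1)%:R * fnorm f.
Proof.
move=> hf; pose y := qadj b f; pose y0 := qadj pred0 f.
have -> : fnorm (fun S => Uop b f S - Uop pred0 f S) =
    fnorm (fun S => (qop b y S - qop pred0 y S) + qop pred0 (fun S => y S - y0 S) S).
  rewrite -fnormN; apply: eq_fnorm => S; rewrite /= (qopB pred0 y y0) [RHS]addrA subrK.
  by rewrite /Uop (opprB (f S - _)) subrBB.
apply: le_trans (fnormD2_le _ _) _; rewrite fnorm_qop.
set r := (d%:R^-1 : C); have r0 : 0 <= r by rewrite invr_ge0 ler0n.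
have h1 : fnorm (fun S => qop b y S - qop pred0 y S) <=
    r * (4 * t.+1)%:R * (2 * fnorm f).
  apply: le_trans (fnorm_qop_diff b (deg_le_qadj b hf)) _.
  by rewrite ler_wpM2l ?fnorm_qadj // mulr_ge0 ?ler0n.
have h2 := fnorm_qadj_diff b hf.
(* The constant 32 is 2*4*2 + 2*2*4: a factor 2 for splitting the sum, 4 from the changed factor and
   2 from the unchanged one. *)
apply: (@le_trans _ _ (2 * (r * (4 * t.+1)%:R * (2 * fnorm f)) +
    2 * (2 * (r * (4 * t.+1)%:R * fnorm f)))).
  by apply: lerD; rewrite !ler_pM2l ?ltr0n.
rewrite !natrM le_eqVlt; apply/orP; left; apply/eqP; ring.
Qed.

(** * The purified run and the hybrid argument *)

Section Run.
Variables (V : nat -> 'M[C]_N) (v0 : 'cV[C]_N).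
Hypothesis V_unitary : forall t, unitary (V t).
Hypothesis v0_unit : sqn v0 = 1.

(** The run starts on the empty set because the initial state does not depend on the sign vector. *)
Fixpoint purified b t : {set 'I_d} -> 'cV[C]_N :=
  if t is t'.+1 then fun S => V t *m Uop b (purified b t') S
  else fun S => if S == set0 then V 0 *m v0 else 0.

Lemma fnorm_unitary n (W : 'M[C]_n) (f : {set 'I_d} -> 'cV[C]_n) :
  unitary W -> fnorm (fun S => W *m f S) = fnorm f.
Proof. by move=> hW; apply: eq_bigr => S _; rewrite sqn_unitary. Qed.

(** A query toggles at most twice, once in [qadj] and once in [qop]. *)
Lemma deg_le_purified b t : deg_le t.*2 (purified b t).
Proof.
elim: t => [|t IH] S hS /=; first by rewrite -cards_eq0 gtn_eqF.
by rewrite (deg_le_Uop b IH) ?mulmx0.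
Qed.

Lemma fnorm_purified b t : fnorm (purified b t) = 1.
Proof.
elim: t => [|t IH] /=; last by rewrite fnorm_unitary // fnorm_Uop.
rewrite /fnorm (bigD1 set0) //= eqxx big1 ?addr0 => [|S /negPf->].
  by rewrite sqn_unitary.
exact: sqn0.
Qed.

(** Each query adds an error [e] of squared norm at most r and carries the old difference along
    isometrically. Norms thus grow by sqrt r per query, giving t^2 r for the square. *)
Lemma fnorm_purified_diff b T t : (t <= T)%N ->
  fnorm (fun S => purified b t S - purified pred0 t S) <=
  d%:R^-1 * (32 * T.*2.+1)%:R * (t ^ 2)%:R.
Proof.
set r := d%:R^-1 * _; have r0 : 0 <= r by rewrite mulr_ge0 ?invr_ge0 ?ler0n.
elim: t => [_|t IH tT].
  rewrite mulr0 /fnorm big1 // => S _; rewrite /= subrr; exact: sqn0.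
have ht := IH (ltnW tT); pose f := purified b t; pose g := purified pred0 t.
pose e S := Uop b f S - Uop pred0 f S; pose D S := f S - g S.
have -> : fnorm (fun S => purified b t.+1 S - purified pred0 t.+1 S) =
    fnorm (fun S => Uop pred0 D S + e S).
  rewrite -[RHS](fnorm_unitary _ (V_unitary t.+1)); apply: eq_fnorm => S.
  rewrite /= -mulmxBr; congr (_ *m _); rewrite /e.
  have -> : Uop pred0 D S = Uop pred0 f S - Uop pred0 g S.
    rewrite /Uop; have -> : qop pred0 (qadj pred0 D) S =
        qop pred0 (fun S => qadj pred0 f S - qadj pred0 g S) S.
      by rewrite /qop !qadjB; congr (_ - _ *: _); apply: eq_bigr => j _; rewrite qadjB.
    rewrite (qopB pred0 (qadj pred0 f) (qadj pred0 g)) /D; exact: subr_interchange.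
  exact: subr_trans.
have he : fnorm e <= r.
  apply: le_trans (fnorm_Uop_diff b (@deg_le_purified b t)) _.
  rewrite fnorm_purified mulr1 ler_wpM2l ?invr_ge0 ?ler0n // ler_nat leq_mul2l /=.
  by rewrite ltnS leq_double ltnW.
(* Before the first query the states agree and only [e] remains; the weight used afterwards is the
   inverse of a positive query count. *)
case: t @f @g @e @D {IH} ht he tT => [|t] f g e D ht he tT.
  rewrite mulr1; apply: le_trans he; rewrite le_eqVlt; apply/orP; left; apply/eqP.
  have D0 S : D S = 0 by rewrite /D /f /g /= subrr.
  have qadj0 S : qadj pred0 D S = 0.
    by rewrite /qadj D0 mulmx0 big1 ?scaler0 ?subr0 // => j _; rewrite D0 mulmx0 scaler0.
  apply: eq_fnorm => S; rewrite /Uop /qop D0 qadj0 mulmx0 big1 => [|j _].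
    by rewrite scaler0 !subr0 add0r.
  by rewrite qadj0 mulmx0 scaler0.
(* With x = t+1 and weight 1/x the bound closes exactly: (1 + 1/x) x^2 + (1 + x) = (x + 1)^2. *)
have t0 : 0 < (t.+1%:R^-1 : C) by rewrite invr_gt0 ltr0n.
apply: le_trans (fnormD_le _ _ t0) _; rewrite fnorm_Uop invrK.
have tne : t.+1%:R != 0 :> C by rewrite pnatr_eq0.
apply: (@le_trans _ _ ((1 + t.+1%:R^-1) * (r * (t.+1 ^ 2)%:R) + (1 + t.+1%:R) * r)).
  apply: lerD; rewrite ler_wpM2l //; first by rewrite addr_ge0 ?ler01 // ltW.
  by rewrite addr_ge0 ?ler01 ?ler0n.
rewrite le_eqVlt; apply/orP; left; apply/eqP; rewrite !natrX.
have -> : t.+2%:R = 1 + t.+1%:R :> C by rewrite -natr1 addrC.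
move: (t.+1%:R) r tne {r0 he ht t0} => x r xne; by field.
Qed.

(** Weight 1/2 in [sqrD_le] gives the factors 3/2 and 3. The first is small enough that 3/2 * 1/3 =
    1/2 stays below 2/3. *)
Lemma accept_purified_le (P : pred 'I_N) b t :
  \sum_S \sum_(i | P i) `|purified pred0 t S i 0| ^+ 2 <=
  3 / 2 * (\sum_S \sum_(i | P i) `|purified b t S i 0| ^+ 2) +
  3 * (d%:R^-1 * (32 * t.*2.+1)%:R * (t ^ 2)%:R).
Proof.
apply: (@le_trans _ _ (3 / 2 *
    (\sum_S \sum_(i | P i) `|purified b t S i 0| ^+ 2) +
  3 * fnorm (fun S => purified b t S - purified pred0 t S))); last first.
  by rewrite lerD2l ler_pM2l ?ltr0n // fnorm_purified_diff.
rewrite /fnorm !mulr_sumr -big_split /=; apply: ler_sum => S _.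
set u := purified b t S; set v := purified pred0 t S.
apply: (@le_trans _ _ (\sum_(i | P i)
    (3 / 2 * `|u i 0| ^+ 2 + 3 * `|(u - v) i 0| ^+ 2))).
  apply: ler_sum => i _; have h0 : 0 < (2^-1 : C) by rewrite invr_gt0 ltr0n.
  have := sqrD_le (u i 0) (- (u - v) i 0) h0; rewrite invrK normrN.
  have -> : u i 0 + - (u - v) i 0 = v i 0 by rewrite !mxE opprB addrC subrK.
  by have -> : 1 + 2^-1 = 3 / 2 :> C by field.
rewrite big_split /= -!mulr_sumr lerD2l ler_pM2l ?ltr0n // /sqn big_mkcond /=.
by apply: ler_sum => i _; case: ifP => // _; apply: exprn_ge0.
Qed.

Lemma ev_purified0 b x : ev b x (purified b 0) = V 0 *m v0.
Proof.
rewrite /ev (bigD1 set0) //= eqxx big1 ?addr0 => [|S /negPf->]; last exact: scaler0.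
by rewrite /wt big_set0 scale1r.
Qed.

Lemma ev_purifiedS b x t :
  ev b x (purified b t.+1) = V t.+1 *m (refl b x *m ev b x (purified b t)).
Proof. by rewrite ev_mulmx ev_Uop. Qed.

End Run.

End Purification.

(** * The hard state preparation unitaries *)

Section HardInstances.
Variables (C : numClosedFieldType) (d : nat).
Hypothesis d_gt0 : (0 < d)%N.
Implicit Types (b : pred 'I_d) (x : {set 'I_d}).

Lemma second_index_proof : (1 < 2 * d)%N.
Proof. by rewrite mul2n -addnn; case: d d_gt0 => [//|k] _; rewrite addnS. Qed.

(** The basis state |1> of register A, which keeps the prepared state orthogonal to |0>. *)
Definition flag : 'I_(2 * d) := Ordinal second_index_proof.

Definition basis1 j : 'cV[C]_(2 * d * d) := delta_mx (mxtens_index (flag, j)) 0.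

Definition scale : C := (sqrtC d%:R)^-1.

Definition psi b x : 'cV[C]_d := \col_j (scale * phase C b x j).

Lemma scale_real : scale^* = scale.
Proof.
by apply/CrealP; rewrite rpredV ger0_real // sqrtC_ge0 ler0n.
Qed.

Lemma scale_sqr : scale ^+ 2 = d%:R^-1.
Proof. by rewrite exprVn sqrtCK. Qed.

Lemma norm_scale_sqr : `|scale| ^+ 2 = d%:R^-1.
Proof. by rewrite normCK scale_real -expr2 scale_sqr. Qed.

Lemma adj_ket0_basis1 j : adjmx (ket0 C (2 * d * d)) *m basis1 j = 0.
Proof.
apply/matrixP => a c; rewrite !mxE big1 // => i _; rewrite !mxE.
have [-> /=|_] := eqVneq i (mxtens_index (flag, j)); last by rewrite mulr0.
by rewrite mul1n addn_eq0 eqn0Ngt d_gt0 conjC0 mul0r.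
Qed.

Lemma adj_ket0_ket0 n : (0 < n)%N -> adjmx (ket0 C n) *m ket0 C n = 1%:M.
Proof.
case: n => [//|n] _; apply/matrixP => a c; rewrite !ord1 !mxE (bigD1 ord0) //=.
rewrite big1 ?addr0 => [|i]; first by rewrite !mxE conjC1 mulr1.
by rewrite !mxE -(inj_eq val_inj) /= => /negPf->; rewrite mulr0.
Qed.

Lemma adj_basis1 j k : adjmx (basis1 j) *m basis1 k = (j == k)%:R%:M.
Proof.
apply/matrixP => a c; rewrite !ord1 mxE (bigD1 (mxtens_index (flag, k))) //=.
rewrite big1 ?addr0 => [|i /negPf ik]; last by rewrite [X in _ * X]mxE ik mulr0.
rewrite !mxE !eqxx mulr1 rmorph_nat (can_eq (@mxtens_indexK _ _)).
by rewrite xpair_eqE eqxx eq_sym andbT mulr1n.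
Qed.

Definition hardU b x := refl (ket0 C (2 * d * d)) basis1 scale b x.

Lemma dim_gt0 : (0 < 2 * d * d)%N.
Proof. by rewrite !muln_gt0 d_gt0. Qed.

Lemma hardU_unitary b x : unitary (hardU b x).
Proof.
apply: refl_unitary => //; first exact/adj_ket0_ket0/dim_gt0.
- exact: adj_ket0_basis1.
- exact: adj_basis1.
- exact: scale_real.
- exact: scale_sqr.
Qed.

Lemma hardU_hermitian b x : adjmx (hardU b x) = hardU b x.
Proof. by rewrite /hardU /refl adjmxB adjmx1 adjmxM adjmxK. Qed.

(** The adjoint of q = |0> - |1>|psi> maps |0> to 1, so the reflection sends |0> to |0> - q. *)
Lemma hardU_ket0 b x :
  hardU b x *m ket0 C (2 * d * d) = scale *: \sum_j phase C b x j *: basis1 j.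
Proof.
rewrite /hardU /refl mulmxBl mul1mx -mulmxA.
suff -> : adjmx (qvec (ket0 C (2 * d * d)) basis1 scale b x) *m ket0 C (2 * d * d) = 1%:M.
  by rewrite mulmx1 /qvec opprB addrC subrK.
rewrite -[LHS]adjmxK adjmxM adjmxK /qvec mulmxBr adj_ket0_ket0 ?dim_gt0 //.
rewrite -scalemxAr mulmx_sumr big1 ?scaler0 ?subr0 ?adjmx1 // => j _.
by rewrite -scalemxAr adj_ket0_basis1 scaler0.
Qed.

Lemma hardU_state_prep b x : state_prep (hardU b x) (psi b x *m adjmx (psi b x)).
Proof.
split; first exact: hardU_unitary.
have e i j : (hardU b x *m ket0 C (2 * d * d)) (mxtens_index (i, j)) 0 =
    (i == flag)%:R * psi b x j 0.
  rewrite hardU_ket0 mxE summxE (bigD1 j) //= big1 ?addr0 => [|k kj].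
    rewrite !mxE (can_eq (@mxtens_indexK _ _)) xpair_eqE !eqxx !andbT.
    by rewrite mulrA mulrC.
  rewrite !mxE (can_eq (@mxtens_indexK _ _)) xpair_eqE.
  by rewrite [j == k]eq_sym (negPf kj) andbF mulr0.
apply/matrixP => j k; rewrite !mxE (bigD1 flag) //= big1 ?addr0 => [|i ne].
  by rewrite !mxE !big_ord1 !adjmxE !e eqxx !mul1r.
by rewrite !mxE !big_ord1 !adjmxE !e (negPf ne) !mul0r.
Qed.

Lemma psi_pure b x : pure_state (psi b x).
Proof.
rewrite /pure_state (eq_bigr (fun=> d%:R^-1)) => [|j _].
  by rewrite sumr_const card_ord -[LHS]mulr_natl mulfV // pnatr_eq0 -lt0n.
by rewrite mxE normrM norm_phase mulr1 norm_scale_sqr.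
Qed.

(** Squaring the amplitudes erases the signs, so [x] drops out. *)
Lemma realness_psi b x :
  realness (psi b x) = d%:R^-1 ^+ 2 * `|\sum_j eta C b j| ^+ 2.
Proof.
rewrite /realness (eq_bigr (fun j => d%:R^-1 * eta C b j)) => [|j _].
  by rewrite -mulr_sumr normrM exprMn ger0_norm // invr_ge0 ler0n.
by rewrite mxE exprMn scale_sqr phase_sqr.
Qed.

Lemma realness_real x : realness (psi pred0 x) = 1.
Proof.
rewrite realness_psi /eta sumr_const card_ord normr_nat -exprMn mulVf ?expr1n //.
by rewrite pnatr_eq0 -lt0n.
Qed.

(** The alternating sum of d signs is 0 or 1, so the realness is at most 1/d^2 <= 1/16. *)
Lemma realness_odd x : (3 < d)%N -> realness (psi (fun j => odd j) x) < 1 / 10.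
Proof.
move=> d3; rewrite realness_psi.
have -> : \sum_j eta C (fun j : 'I_d => odd j) j = (odd d)%:R.
  rewrite /eta; elim: (d) => [|k IH]; first by rewrite big_ord0.
  rewrite big_ord_recr /= IH; case: (odd k); by rewrite ?subrr ?add0r.
apply: (@le_lt_trans _ _ (d%:R^-1 ^+ 2)).
  rewrite ler_piMr ?exprn_ge0 ?invr_ge0 ?ler0n // exprn_ile1 ?normr_ge0 //.
  by rewrite normr_nat lern1; case: (odd d).
rewrite div1r exprVn ltf_pV2 ?posrE ?exprn_gt0 ?ltr0n // -natrX ltr_nat.
by apply: (@leq_trans (4 ^ 2)); rewrite ?leq_sqr.
Qed.

(** * Averaging an algorithm over the hard instances *)

Section Algorithm.
Variable A : qalgo C (2 * d * d).
Hypothesis kindsA : all (fun k => qkind_eqb k QU || qkind_eqb k QUadj) (kinds A).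

Let w := ws A.
Let B0 : 'M[C]_(w * (2 * d * d), w * 1) := 1%:M *t ket0 C (2 * d * d).
Let E j : 'M[C]_(w * (2 * d * d), w * 1) := 1%:M *t basis1 j.

Lemma tens1_scalar n (c : C) : (1%:M : 'M_n) *t (c%:M : 'M_1) = c%:M.
Proof.
apply/matrixP => i j; rewrite -(mxtens_unindexK i) -(mxtens_unindexK j).
case: (mxtens_unindex i) (mxtens_unindex j) => {}i i' [{}j j'].
rewrite tensmxE !mxE (can_eq (@mxtens_indexK _ _)) xpair_eqE !ord1 eqxx.
by rewrite andbT mulr1n; case: (i == j); rewrite ?mul1r ?mul0r.
Qed.

Lemma refl_tens b x : refl B0 E scale b x = (1%:M : 'M_w) *t hardU b x.
Proof.
have q : qvec B0 E scale b x =
    (1%:M : 'M_w) *t qvec (ket0 C (2 * d * d)) basis1 scale b x.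
  apply/matrixP => i j; rewrite /qvec /B0 /E !mxE mulrBr; congr (_ - _).
  rewrite !summxE mulrCA; congr (_ * _); rewrite mulr_sumr; apply: eq_bigr => k _.
  by rewrite !mxE mulrCA.
rewrite /hardU /refl q adjmx_tens adjmx1 tensmx_mul mulmx1.
apply/matrixP => i j; rewrite -(mxtens_unindexK i) -(mxtens_unindexK j).
case: (mxtens_unindex i) (mxtens_unindex j) => {}i i' [{}j j'].
rewrite tensmxE [LHS]mxE [X in _ + X]mxE tensmxE [X in _ = _ * X]mxE mulrDr mxE.
rewrite (can_eq (@mxtens_indexK _ _)) xpair_eqE [X in _ * X + _]mxE.
rewrite [X in _ = _ + _ * X]mxE mulrN; congr (_ - _); rewrite mxE.
by case: (i == j); rewrite ?mul1r ?mul0r.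
Qed.

Notation state b t := (purified B0 E scale (gates A) (ket0 C _) b t).

(** The hard unitaries are Hermitian, so both permitted kinds of query act as the same
    reflection. *)
Lemma run_purified b x (ks : seq qkind) t :
  all (fun k => qkind_eqb k QU || qkind_eqb k QUadj) ks ->
  run_from (gates A) (hardU b x) ks t (ev b x (state b t)) =
  ev b x (state b (t + size ks)).
Proof.
elim: ks t => [|k ks IH] t /=; first by rewrite addn0.
case/andP => hk hks; rewrite addnS -addSn -IH // (ev_purifiedS _ _ scale_real).
rewrite refl_tens -mulmxA; congr (run_from _ _ _ _ (_ *m (_ *t _ *m _))).
by case: k hk => //= _; rewrite hardU_hermitian.
Qed.

Lemma final_state_purified b x :
  final_state A (hardU b x) = ev b x (state b (num_queries A)).
Proof.
by rewrite -[num_queries A]add0n -(run_purified b x 0 kindsA) ev_purified0.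
Qed.

(** Parseval moves the average over [x] to the Fourier coefficients, where the two phase patterns
    can be compared. *)
Lemma sum_accept_prob b :
  \sum_x accept_prob A (hardU b x) = (2 ^ d)%:R *
    \sum_S \sum_(i | @acc _ _ A i) `|state b (num_queries A) S i 0| ^+ 2.
Proof.
rewrite -(parseval b); apply: eq_bigr => x _.
by rewrite /accept_prob final_state_purified.
Qed.

Lemma query_lower_bound : (3 < d)%N -> solves_reality_testing A ->
  (d <= 576 * (num_queries A).*2.+1 * num_queries A ^ 2)%N.
Proof.
move=> d3 solA; set T := num_queries A.
have w0 : (0 < w)%N.
  have [h _] := solA _ (psi_pure pred0 set0) _ (hardU_state_prep pred0 set0).
  rewrite lt0n; apply/eqP => wz; have := h (realness_real _); rewrite /accept_prob.
  rewrite big1 => [|i _]; first by move/le_gtF; rewrite divr_gt0 ?ltr0n.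
  by have := ltn_ord i; rewrite [X in (_ < X * _)%N]wz mul0n.
pose acceptance b := \sum_S \sum_(i | @acc _ _ A i) `|state b T S i 0| ^+ 2.
have pow0 : 0 < (2 ^ d)%:R :> C by rewrite ltr0n expn_gt0.
have cst (c : C) : \sum_(x : {set 'I_d}) c = (2 ^ d)%:R * c.
  by rewrite sumr_const -[LHS]mulr_natl -cardsT -powersetT card_powerset cardsT card_ord.
have h1 : 2 / 3 <= acceptance pred0.
  rewrite -(ler_pM2l pow0) -sum_accept_prob -cst; apply: ler_sum => x _.
  have [h _] := solA _ (psi_pure pred0 x) _ (hardU_state_prep pred0 x).
  exact: h (realness_real x).
have h2 : acceptance (fun j => odd j) <= 1 / 3.
  rewrite -(ler_pM2l pow0) -sum_accept_prob -cst; apply: ler_sum => x _.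
  have [_ h] := solA _ (psi_pure _ x) _ (hardU_state_prep (fun j => odd j) x).
  exact: h (realness_odd x d3).
have h3 := @accept_purified_le _ _ _ _ B0 E scale d_gt0 _ _ _ scale_real scale_sqr
  (gates A) (ket0 C _) (@gates_unitary _ _ A) _ (@acc _ _ A) (fun j => odd j) T.
have {}h3 : 2 / 3 <= 3 / 2 * (1 / 3) +
    3 * (d%:R^-1 * (32 * T.*2.+1)%:R * (T ^ 2)%:R) :> C.
  apply: le_trans h1 _; apply: le_trans (h3 _ _ _ _) _.
  - rewrite /B0 adjmx_tens adjmx1 tensmx_mul mulmx1 adj_ket0_ket0 ?dim_gt0 //.
    exact: tens1_scalar.
  - by move=> j; rewrite /B0 /E adjmx_tens adjmx1 tensmx_mul adj_ket0_basis1 tensmx0.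
  - by move=> j k; rewrite /E adjmx_tens adjmx1 tensmx_mul mulmx1 adj_basis1 tens1_scalar.
  - by rewrite sqnE adj_ket0_ket0 ?mxE // muln_gt0 w0 dim_gt0.
  by rewrite lerD2r ler_pM2l ?divr_gt0 ?ltr0n.
have dne : d%:R != 0 :> C by rewrite pnatr_eq0 -lt0n.
rewrite -(ler_nat C) -subr_ge0.
(* The gap left to the hybrid error is 2/3 - 1/2 = 1/6; multiplying by 6d gives 6 * 3 * 32 = 576. *)
have -> : (576 * T.*2.+1 * T ^ 2)%:R - d%:R = (6 * d%:R) * (3 / 2 * (1 / 3) +
    3 * (d%:R^-1 * (32 * T.*2.+1)%:R * (T ^ 2)%:R) - 2 / 3) :> C.
  by rewrite !natrM; field.
by rewrite mulr_ge0 ?subr_ge0 // mulr_ge0 ?ler0n.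
Qed.

End Algorithm.

End HardInstances.

(** * Permutation gates and symmetrizing gates *)

Section PermutationGates.
Variables (C : numClosedFieldType) (m : nat) (sigma : 'I_m -> 'I_m).

Definition reindexmx : 'M[C]_m := \matrix_(i, k) (k == sigma i)%:R.

Lemma reindexmxE (v : 'cV[C]_m) i : (reindexmx *m v) i 0 = v (sigma i) 0.
Proof.
rewrite mxE (bigD1 (sigma i)) //= big1 ?addr0 => [|k /negPf ne].
  by rewrite mxE eqxx mul1r.
by rewrite mxE ne mul0r.
Qed.

Lemma reindexmx_unitary : injective sigma -> unitary reindexmx.
Proof.
move=> inj; apply/matrixP => i k; rewrite mxE (bigD1 (sigma i)) //= big1 ?addr0.
  by rewrite adjmxE !mxE eqxx mul1r rmorph_nat (inj_eq inj).
by move=> l /negPf ne; rewrite mxE ne mul0r.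
Qed.

End PermutationGates.

(* Diagonalises the swap-like involution sigma: on each two-point orbit it acts
   as a Hadamard gate, with the symmetric combination stored at the point
   selected by the predicate a, so that measuring a projects onto the
   sigma-invariant vectors. *)
Section SymmetrizingGate.
Variables (C : numClosedFieldType) (m : nat) (sigma : 'I_m -> 'I_m) (a : pred 'I_m).
Hypothesis sigmaK : involutive sigma.
Hypothesis a_fix : forall i, sigma i = i -> a i.
Hypothesis a_swap : forall i, sigma i != i -> a (sigma i) = ~~ a i.

Let r : C := (sqrtC 2)^-1.

Definition symmx : 'M[C]_m := \matrix_(i, k)
  if sigma i == i then (k == i)%:R
  else r * ((k == sigma i)%:R + (-1) ^+ (~~ a i) * (k == i)%:R).

Lemma symmxE (v : 'cV[C]_m) i : (symmx *m v) i 0 =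
  if sigma i == i then v i 0 else r * (v (sigma i) 0 + (-1) ^+ (~~ a i) * v i 0).
Proof.
have sel k : \sum_l (l == k)%:R * v l 0 = v k 0.
  rewrite (bigD1 k) //= big1 ?addr0 ?eqxx ?mul1r // => l /negPf->.
  by rewrite mul0r.
rewrite mxE; under eq_bigr => k _ do rewrite mxE.
case: eqP => _; first exact: sel.
under eq_bigr => k _ do rewrite -mulrA mulrDl -mulrA.
by rewrite -mulr_sumr big_split /= -mulr_sumr !sel.
Qed.

Let r_sqr : r ^+ 2 = 2^-1.
Proof. by rewrite exprVn sqrtCK. Qed.

Let r_real : r^* = r.
Proof. by apply/CrealP; rewrite rpredV ger0_real // sqrtC_ge0 ler0n. Qed.

Lemma sigma_fixE i : (sigma (sigma i) == sigma i) = (sigma i == i).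
Proof. by rewrite (inj_eq (inv_inj sigmaK)). Qed.

(** The matrix is real symmetric and squares to 1, since the two points of an orbit carry opposite
    signs and r^2 = 1/2. *)
Lemma symmx_unitary : unitary symmx.
Proof.
rewrite /unitary; have -> : adjmx symmx = symmx.
  apply/matrixP => i k; rewrite adjmxE !mxE.
  have [->|ne] := eqVneq i k.
    case: ifP => _; first by rewrite rmorph_nat.
    rewrite rmorphM /= r_real rmorphD rmorphM rmorphXn rmorphN rmorph1 !rmorph_nat.
    by [].
  have -> : (i == sigma k) = (k == sigma i).
    by apply/eqP/eqP => ->; rewrite sigmaK.
  rewrite !mulr0 !addr0.
  have [->|nk] := eqVneq k (sigma i).
    rewrite sigma_fixE; case: ifP => _; first by rewrite rmorph_nat.
    by rewrite rmorphM /= r_real rmorph1.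
  by rewrite !mulr0; case: ifP; case: ifP; rewrite rmorph0.
have h (v : 'cV[C]_m) : symmx *m (symmx *m v) = v.
  apply/colP => i; rewrite symmxE !symmxE sigma_fixE sigmaK.
  have [//|ne] := boolP (sigma i == i); rewrite a_swap //.
  transitivity (2 * r ^+ 2 * v i 0); last by rewrite r_sqr mulfV ?mul1r ?pnatr_eq0.
  by case: (a i); rewrite /= ?expr0 ?expr1; ring.
apply/matrixP => i k.
have := congr1 (fun w : 'cV_m => w i 0) (h (delta_mx k 0)).
by rewrite mulmxA -colE !mxE eq_sym => ->; rewrite eqxx andbT.
Qed.

(** On every orbit [Q i + Q (sigma i)] is half of |v i + v (sigma i)|^2, fixed points included.
    Summing over all i counts [Q] twice, whence 1/4. *)
Lemma symmetrized_weight (P : pred 'I_m) (v : 'cV[C]_m) :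
  (forall i, P (sigma i) = P i) ->
  \sum_(i | P i && a i) `|(symmx *m v) i 0| ^+ 2 =
  4^-1 * \sum_(i | P i) `|v i 0 + v (sigma i) 0| ^+ 2.
Proof.
move=> Ps; pose Q i : C := if a i then `|(symmx *m v) i 0| ^+ 2 else 0.
have r_norm : `|r| ^+ 2 = 2^-1 by rewrite normCK r_real -expr2 r_sqr.
have QQ i : Q i + Q (sigma i) = 2^-1 * `|v i 0 + v (sigma i) 0| ^+ 2.
  rewrite /Q !symmxE sigma_fixE sigmaK; case: eqP => [e|/eqP ne].
    rewrite e a_fix // -mulr2n -[v i 0 + v i 0]mulr2n -[v i 0 *+ 2]mulr_natl.
    rewrite normrM normr_nat exprMn -[LHS]mulr_natl; by field.
  rewrite a_swap //; case: (a i); rewrite /= expr0 mul1r.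
    by rewrite addr0 normrM exprMn r_norm addrC.
  by rewrite add0r normrM exprMn r_norm.
have sQ : \sum_(i | P i) Q (sigma i) = \sum_(i | P i) Q i.
  rewrite [RHS](reindex_inj (inv_inj sigmaK)) /=.
  by apply: eq_bigl => i; rewrite Ps.
have -> : \sum_(i | P i && a i) `|(symmx *m v) i 0| ^+ 2 = \sum_(i | P i) Q i.
  by rewrite big_mkcondr.
have -> : \sum_(i | P i) Q i = 2^-1 * \sum_(i | P i) (Q i + Q (sigma i)).
  by rewrite big_split /= sQ -mulr2n -[X in _ = _ * X]mulr_natl mulKf ?pnatr_eq0.
rewrite (eq_bigr _ (fun i _ => QQ i)) -mulr_sumr mulrA; congr (_ * _).
by rewrite -invfM -natrM.
Qed.

End SymmetrizingGate.

(** * Four registers and a pair of swap tests *)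

Section FourRegisters.
Variables (C : numClosedFieldType) (n : nat).
Hypothesis n_gt0 : (0 < n)%N.

Definition split4 (i : 'I_(n * n * n * n)) : ('I_n * 'I_n) * ('I_n * 'I_n) :=
  let k := mxtens_unindex i in let l := mxtens_unindex k.1 in
  (mxtens_unindex l.1, (l.2, k.2)).

Definition join4 (u : ('I_n * 'I_n) * ('I_n * 'I_n)) : 'I_(n * n * n * n) :=
  mxtens_index (mxtens_index (mxtens_index u.1, u.2.1), u.2.2).

Lemma split4K : cancel split4 join4.
Proof.
move=> i; rewrite -(mxtens_unindexK i); case: (mxtens_unindex i) => l e.
rewrite -(mxtens_unindexK l); case: (mxtens_unindex l) => p c.
by rewrite /split4 /join4 !mxtens_indexK /= mxtens_unindexK.
Qed.

Lemma join4K : cancel join4 split4.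
Proof. by case=> [[a b] [c e]]; rewrite /split4 /join4 !mxtens_indexK. Qed.

Definition prod4 (f1 f2 f3 f4 : 'cV[C]_n) : 'cV[C]_(n * n * n * n) :=
  \col_i let u := split4 i in
    (f1 u.1.1 0 * f2 u.1.2 0) * (f3 u.2.1 0 * f4 u.2.2 0).

Lemma sum_split4 (F : ('I_n * 'I_n) * ('I_n * 'I_n) -> C) :
  \sum_i F (split4 i) = \sum_u F u.
Proof.
rewrite [RHS](reindex split4) //; exists join4 => ? _; [exact: split4K | exact: join4K].
Qed.

Lemma prod4E f1 f2 f3 f4 u : prod4 f1 f2 f3 f4 (join4 u) 0 =
  (f1 u.1.1 0 * f2 u.1.2 0) * (f3 u.2.1 0 * f4 u.2.2 0).
Proof. by rewrite mxE join4K. Qed.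

Lemma tens_mulmxE w (O : 'M[C]_n) (v : 'cV[C]_(w * n)) i j :
  (((1%:M : 'M_w) *t O) *m v) (mxtens_index (i, j)) 0 =
  \sum_k O j k * v (mxtens_index (i, k)) 0.
Proof.
rewrite mxE (reindex (@mxtens_index w n)) /=; last first.
  by exists (@mxtens_unindex w n) => ? _; rewrite (mxtens_indexK, mxtens_unindexK).
transitivity (\sum_k \sum_l ((1%:M : 'M_w) *t O) (mxtens_index (i, j))
    (mxtens_index (k, l)) * v (mxtens_index (k, l)) 0).
  by rewrite pair_bigA; apply: eq_bigr => -[k l] _.
rewrite (bigD1 i) //= [X in _ + X]big1 ?addr0 => [|k /negPf ne].
  by apply: eq_bigr => k _; rewrite tensmxE mxE eqxx mul1r.
by apply: big1 => l _; rewrite tensmxE mxE eq_sym ne !mul0r.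
Qed.

Lemma prod4_query (O : 'M[C]_n) f1 f2 f3 f4 :
  ((1%:M : 'M_(n * n * n)) *t O) *m prod4 f1 f2 f3 f4 = prod4 f1 f2 f3 (O *m f4).
Proof.
apply/colP => i; rewrite -(split4K i); case: (split4 i) => [[a b] [c e]].
rewrite prod4E [X in _ = _ * (_ * X)]mxE /= !mulr_sumr.
apply: etrans (tens_mulmxE _ _ (mxtens_index (mxtens_index (a, b), c)) e) _.
apply: eq_bigr => k _; rewrite -[mxtens_index _]/(join4 ((a, b), (c, k))) prod4E /=.
by rewrite mulrCA; congr (_ * _); rewrite mulrCA.
Qed.

(** A cyclic shift of the registers: queries act on the last one only, so this brings a fresh
    register there. *)
Definition rot4 i := let u := split4 i in
  join4 ((u.1.2, u.2.1), (u.2.2, u.1.1)).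

Lemma rot4_inj : injective rot4.
Proof.
move=> i k /(can_inj join4K); case Ei: (split4 i) => [[a b] [c e]].
case Ek: (split4 k) => [[a' b'] [c' e']] /= [eb ec ee ea].
by apply: (can_inj split4K); rewrite Ei Ek ea eb ec ee.
Qed.

Lemma prod4_rot f1 f2 f3 f4 :
  reindexmx C rot4 *m prod4 f1 f2 f3 f4 = prod4 f4 f1 f2 f3.
Proof.
apply/colP => i; rewrite reindexmxE !mxE /rot4 join4K /=.
case: (split4 i) => [[a b] [c e]] /=; ring.
Qed.

Lemma prod4_ket0 :
  prod4 (ket0 C n) (ket0 C n) (ket0 C n) (ket0 C n) = ket0 C (n * n * n * n).
Proof.
apply/colP => i; rewrite -(split4K i); case: (split4 i) => [[a b] [c e]].
rewrite prod4E !mxE /=.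
rewrite !addn_eq0 !muln_eq0 !addn_eq0 !muln_eq0 !addn_eq0 !muln_eq0.
rewrite !(gtn_eqF n_gt0) !orbF.
case: (val a == 0%N); case: (val b == 0%N); case: (val c == 0%N);
  case: (val e == 0%N); by rewrite /= ?(mul0r, mulr0, mul1r).
Qed.

Section PairSwap.
Variables (tau : 'I_n * 'I_n -> 'I_n * 'I_n) (key : pred ('I_n * 'I_n)).
Hypothesis tauK : involutive tau.
Hypothesis key_fix : forall u, tau u = u -> key u.
Hypothesis key_swap : forall u, tau u != u -> key (tau u) = ~~ key u.

Definition swap12 i := join4 (tau (split4 i).1, (split4 i).2).
Definition swap34 i := join4 ((split4 i).1, tau (split4 i).2).
Definition key12 i := key (split4 i).1.
Definition key34 i := key (split4 i).2.

Lemma swap12K : involutive swap12.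
Proof.
move=> i; rewrite -{2}(split4K i) /swap12 join4K.
by case: (split4 i) => u u' /=; rewrite tauK.
Qed.

Lemma swap34K : involutive swap34.
Proof.
move=> i; rewrite -{2}(split4K i) /swap34 join4K.
by case: (split4 i) => u u' /=; rewrite tauK.
Qed.

Lemma swap12_fixE i : (swap12 i == i) = (tau (split4 i).1 == (split4 i).1).
Proof.
rewrite -(inj_eq (can_inj split4K)) /swap12 join4K; case: (split4 i) => u u' /=.
by rewrite xpair_eqE eqxx andbT.
Qed.

Lemma swap34_fixE i : (swap34 i == i) = (tau (split4 i).2 == (split4 i).2).
Proof.
rewrite -(inj_eq (can_inj split4K)) /swap34 join4K; case: (split4 i) => u u' /=.
by rewrite xpair_eqE eqxx.
Qed.

Lemma key12_fix i : swap12 i = i -> key12 i.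
Proof. by move/eqP; rewrite swap12_fixE => /eqP; apply: key_fix. Qed.

Lemma key34_fix i : swap34 i = i -> key34 i.
Proof. by move/eqP; rewrite swap34_fixE => /eqP; apply: key_fix. Qed.

Lemma key12_swap i : swap12 i != i -> key12 (swap12 i) = ~~ key12 i.
Proof. by rewrite swap12_fixE /key12 /swap12 join4K; apply: key_swap. Qed.

Lemma key34_swap i : swap34 i != i -> key34 (swap34 i) = ~~ key34 i.
Proof. by rewrite swap34_fixE /key34 /swap34 join4K; apply: key_swap. Qed.

Definition two_swap_tests : 'M[C]_(n * n * n * n) :=
  symmx C swap12 key12 *m symmx C swap34 key34.

Lemma two_swap_tests_unitary : unitary two_swap_tests.
Proof.
apply: unitaryM; apply: symmx_unitary.
- exact: swap12K.
- exact: key12_swap.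
- exact: swap34K.
- exact: key34_swap.
Qed.

(** The swaps act on disjoint pairs and commute. Symmetrizing the first pair therefore replaces v by
    v + v' before the second gate, and symmetrizing the second pair makes the sum factor. *)
Lemma two_swap_tests_weight f1 f2 f3 f4 :
  \sum_(i | key34 i && key12 i)
     `|(two_swap_tests *m prod4 f1 f2 f3 f4) i 0| ^+ 2 =
  (4^-1 * \sum_u `|f1 u.1 0 * f2 u.2 0 + f1 (tau u).1 0 * f2 (tau u).2 0| ^+ 2) *
  (4^-1 * \sum_u `|f3 u.1 0 * f4 u.2 0 + f3 (tau u).1 0 * f4 (tau u).2 0| ^+ 2).
Proof.
set v := prod4 _ _ _ _; pose v' : 'cV[C]_(n * n * n * n) := \col_i v (swap12 i) 0.
have k34 i : key34 (swap12 i) = key34 i by rewrite /key34 /swap12 join4K.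
have comm i : swap34 (swap12 i) = swap12 (swap34 i).
  by rewrite /swap34 /swap12 !join4K.
have fix34 i : (swap34 (swap12 i) == swap12 i) = (swap34 i == i).
  by rewrite comm (inj_eq (inv_inj swap12K)).
rewrite -mulmxA (symmetrized_weight swap12K key12_fix key12_swap) //.
set u := symmx C swap34 key34 *m v.
have us i : u (swap12 i) 0 = (symmx C swap34 key34 *m v') i 0.
  rewrite !symmxE fix34 k34 !mxE comm; case: ifP => // _; by rewrite !mxE.
under eq_bigr => i _.
  have -> : u i 0 + u (swap12 i) 0 = (symmx C swap34 key34 *m (v + v')) i 0.
    by rewrite us mulmxDr [RHS]mxE.
  over.
have := symmetrized_weight (P := predT) swap34K key34_fix key34_swap (v + v').
move=> /(_ (fun=> erefl)) /= ->.
pose g u := f1 u.1 0 * f2 u.2 0 + f1 (tau u).1 0 * f2 (tau u).2 0 : C.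
pose g' u := f3 u.1 0 * f4 u.2 0 + f3 (tau u).1 0 * f4 (tau u).2 0 : C.
rewrite (eq_bigr (fun i => `|g (split4 i).1| ^+ 2 * `|g' (split4 i).2| ^+ 2)); last first.
  move=> i _; rewrite -exprMn -normrM; congr (`|_| ^+ 2).
  rewrite !mxE /swap34 /swap12 !join4K /= /g /g'; ring.
rewrite (sum_split4 (fun w => `|g w.1| ^+ 2 * `|g' w.2| ^+ 2)).
rewrite -(pair_bigA _ (fun w w' => `|g w| ^+ 2 * `|g' w'| ^+ 2)) /=.
under eq_bigr => w _ do rewrite -mulr_sumr.
by rewrite -mulr_suml mulrACA mulrA.
Qed.

End PairSwap.

End FourRegisters.

(** * The swap test on B registers *)

Section PartialSwap.
Variables (C : numClosedFieldType) (a b : nat).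

Definition sndB (i : 'I_(a * b)) : 'I_b := (mxtens_unindex i).2.

Definition swapB (u : 'I_(a * b) * 'I_(a * b)) : 'I_(a * b) * 'I_(a * b) :=
  (mxtens_index ((mxtens_unindex u.1).1, sndB u.2),
   mxtens_index ((mxtens_unindex u.2).1, sndB u.1)).

(** Holds at the fixed points of [swapB] and at exactly one point of each two-point orbit. *)
Definition leB (u : 'I_(a * b) * 'I_(a * b)) : bool := (sndB u.1 <= sndB u.2)%N.

Lemma swapBE i j i' j' :
  swapB (mxtens_index (i, j), mxtens_index (i', j')) =
  (mxtens_index (i, j'), mxtens_index (i', j)).
Proof. by rewrite /swapB /sndB !mxtens_indexK. Qed.

Lemma leBE i j i' j' :
  leB (mxtens_index (i, j), mxtens_index (i', j')) = (j <= j')%N.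
Proof. by rewrite /leB /sndB !mxtens_indexK. Qed.

Lemma pair_mxtens_index (u : 'I_(a * b) * 'I_(a * b)) :
  exists i j i' j', u = (mxtens_index (i, j), mxtens_index (i', j')).
Proof.
case: u => x y; rewrite -(mxtens_unindexK x) -(mxtens_unindexK y).
by case: (mxtens_unindex x) (mxtens_unindex y) => [i j] [i' j']; exists i, j, i', j'.
Qed.

Lemma swapBK : involutive swapB.
Proof.
by move=> u; have [i [j [i' [j' ->]]]] := pair_mxtens_index u; rewrite !swapBE.
Qed.

Lemma swapB_fix i j i' j' :
  (swapB (mxtens_index (i, j), mxtens_index (i', j')) ==
   (mxtens_index (i, j), mxtens_index (i', j'))) = (j == j').
Proof.
rewrite swapBE xpair_eqE !(can_eq (@mxtens_indexK _ _)) !xpair_eqE !eqxx /=.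
by rewrite [j' == j]eq_sym andbb.
Qed.

Lemma leB_fix u : swapB u = u -> leB u.
Proof.
have [i [j [i' [j' ->]]]] := pair_mxtens_index u.
by move/eqP; rewrite swapB_fix leBE => /eqP->.
Qed.

Lemma leB_swap u : swapB u != u -> leB (swapB u) = ~~ leB u.
Proof.
have [i [j [i' [j' ->]]]] := pair_mxtens_index u.
by rewrite swapB_fix swapBE !leBE -ltnNge ltn_neqAle eq_sym => ->.
Qed.

Lemma sum_mxtens_index (F : 'I_(a * b) -> C) :
  \sum_i F i = \sum_j \sum_i F (mxtens_index (i, j)).
Proof.
rewrite exchange_big pair_bigA /= (reindex (@mxtens_index a b)) /=.
  by apply: eq_bigr => -[i j].
by exists (@mxtens_unindex a b) => ? _; rewrite (mxtens_indexK, mxtens_unindexK).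
Qed.

(** Expanding the square gives two norms equal to 1 and two cross terms. Summing out the A indices
    in a cross term leaves the sum of (psi_j conj(psi_k))^2 over j and k, which is the realness. *)
Lemma swapB_weight (p : 'cV[C]_(a * b)) (psi : 'cV[C]_b) :
  sqn p = 1 -> ptraceA (p *m adjmx p) = psi *m adjmx psi ->
  4^-1 * \sum_u `|p u.1 0 * (Defs.conjmx p) u.2 0 +
     p (swapB u).1 0 * (Defs.conjmx p) (swapB u).2 0| ^+ 2 = (1 + realness psi) / 2.
Proof.
move=> p1 rho; pose F (u : 'I_(a * b) * 'I_(a * b)) := p u.1 0 * (p u.2 0)^*.
pose X := \sum_u F u * (F (swapB u))^*.
have entry j k : \sum_i p (mxtens_index (i, j)) 0 * (p (mxtens_index (i, k)) 0)^* =
    psi j 0 * (psi k 0)^*.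
  have := congr1 (fun M : 'M_b => M j k) rho; rewrite !mxE !big_ord1 !adjmxE => <-.
  by apply: eq_bigr => i _; rewrite !mxE big_ord1 adjmxE.
have S1 : \sum_u `|F u| ^+ 2 = 1.
  rewrite -[RHS]mulr1 -{1}p1 -p1 /sqn mulr_suml.
  under [in RHS]eq_bigr => i _ do rewrite mulr_sumr.
  rewrite pair_bigA; apply: eq_bigr => u _.
  by rewrite normrM norm_conjC exprMn.
have XE : X = realness psi.
  rewrite /X -(pair_bigA _ (fun x y => F (x, y) * (F (swapB (x, y)))^*)) /=.
  rewrite sum_mxtens_index.
  transitivity (\sum_j \sum_k (psi j 0 * (psi k 0)^*) ^+ 2).
    apply: eq_bigr => j _.
    under eq_bigr => i _ do rewrite sum_mxtens_index.
    rewrite exchange_big; apply: eq_bigr => k _ /=.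
    rewrite -entry expr2 mulr_suml; apply: eq_bigr => i _.
    rewrite mulr_sumr; apply: eq_bigr => i' _.
    rewrite swapBE /F /= rmorphM /= conjCK; ring.
  rewrite /realness normCK rmorph_sum mulr_suml; apply: eq_bigr => j _.
  by rewrite mulr_sumr; apply: eq_bigr => k _; rewrite exprMn rmorphXn.
have swap_sum (G : 'I_(a * b) * 'I_(a * b) -> C) : \sum_u G (swapB u) = \sum_u G u.
  by rewrite [RHS](reindex_inj (inv_inj swapBK)).
have -> : \sum_u `|p u.1 0 * (Defs.conjmx p) u.2 0 +
     p (swapB u).1 0 * (Defs.conjmx p) (swapB u).2 0| ^+ 2 =
   \sum_u `|F u| ^+ 2 + \sum_u `|F (swapB u)| ^+ 2 + X +
   \sum_u F (swapB u) * (F (swapB (swapB u)))^*.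
  rewrite /X -!big_split; apply: eq_bigr => u _ /=.
  rewrite swapBK ![Defs.conjmx _ _ _]mxE -/(F u) -/(F (swapB u)).
  rewrite !normCK rmorphD /=; ring.
rewrite (swap_sum (fun u => `|F u| ^+ 2)) (swap_sum (fun u => F u * (F (swapB u))^*)).
by rewrite -/X XE S1; field.
Qed.

End PartialSwap.

(** * The four-query reality tester *)

Section RealityTester.
Variables (C : numClosedFieldType) (d : nat).
Hypothesis d_gt0 : (0 < d)%N.
Local Notation n := (2 * d * d)%N.

Definition tester_gates (t : nat) : 'M[C]_(n * n * n * n) :=
  match t with
  | 0 => 1%:M
  | 1 | 2 | 3 => reindexmx C (@rot4 n)
  | _ => two_swap_tests C (@swapB (2 * d) d) (@leB (2 * d) d)
  end.

Lemma tester_gates_unitary t : unitary (tester_gates t).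
Proof.
case: t => [|[|[|[|t]]]] /=; first exact: unitary1.
1-3: exact/reindexmx_unitary/rot4_inj.
apply: two_swap_tests_unitary; [exact: swapBK | exact: leB_swap].
Qed.

Definition reality_tester : qalgo C n :=
  @QAlgo C n (n * n * n) [:: QU; QUconj; QU; QUconj] tester_gates
    tester_gates_unitary
    (fun i => key34 (@leB (2 * d) d) i && key12 (@leB (2 * d) d) i).

Lemma reality_tester_prob (psi : 'cV[C]_d) (U : 'M[C]_n) :
  state_prep U (psi *m adjmx psi) ->
  accept_prob reality_tester U = ((1 + realness psi) / 2) ^+ 2.
Proof.
case=> hU rho; have n0 : (0 < n)%N by rewrite !muln_gt0 d_gt0.
set p := U *m ket0 C n; have p1 : sqn p = 1.
  by rewrite sqn_unitary // sqnE adj_ket0_ket0 // mxE.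
have q : Defs.conjmx U *m ket0 C n = Defs.conjmx p.
  rewrite conj_mulmx; congr (_ *m _); apply/matrixP => i j; rewrite !mxE.
  by case: ifP; rewrite (rmorph0, rmorph1).
have -> : accept_prob reality_tester U = \sum_(i | key34 (@leB (2 * d) d) i &&
    key12 (@leB (2 * d) d) i) `|(two_swap_tests C (@swapB (2 * d) d) (@leB (2 * d) d)
      *m prod4 p (Defs.conjmx p) p (Defs.conjmx p)) i 0| ^+ 2.
  (* With q the conjugate of p, the registers right after the successive queries hold (0,0,0,p),
     (p,0,0,q), (q,p,0,p) and (p,q,p,q). *)
  rewrite /accept_prob /final_state /= mul1mx -prod4_ket0 //.
  rewrite -!mulmxA !(prod4_query, prod4_rot) -/p q.
  by [].
rewrite two_swap_tests_weight; [|exact: swapBK|exact: leB_fix|exact: leB_swap].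
by rewrite !(swapB_weight p1 rho) expr2.
Qed.

Lemma reality_tester_solves : solves_reality_testing reality_tester.
Proof.
move=> psi _ U hU; rewrite (reality_tester_prob hU); split => [->|hr].
  have -> : ((1 + 1) / 2) ^+ 2 = 1 :> C by field.
  by rewrite ler_pdivrMr ?ltr0n // mul1r ler_nat.
have r0 : 0 <= realness psi by rewrite exprn_ge0.
(* One test could accept with probability near (1 + 1/10)/2 = 11/20, above 1/3; two tests bring this
   down to 121/400. *)
apply: (@le_trans _ _ ((11 / 20) ^+ 2)).
  rewrite ler_pXn2r ?nnegrE ?divr_ge0 ?addr_ge0 ?ler0n ?ler01 //.
  have -> : 11 / 20 = (1 + 1 / 10) / 2 :> C by field.
  by rewrite ler_pM2r ?invr_gt0 ?ltr0n // lerD2l ltW.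
have -> : 1 / 3 = (11 / 20) ^+ 2 + 37 / 1200 :> C by field.
by rewrite lerDl divr_ge0 ?ler0n.
Qed.

End RealityTester.


Theorem theorem1p3 (R : realType) :
  (* (i) lower bound with access to U and U^dagger only *)
  (exists c : R, 0 < c /\
     forall d : nat, (1000 < d)%N ->
     forall A : qalgo R[i] ((2 * d) * d),
       all (fun k => qkind_eqb k QU || qkind_eqb k QUadj) (kinds A) ->
       solves_reality_testing A ->
       c * Num.sqrt (Num.sqrt (d%:R)) <= (num_queries A)%:R)
  /\
  (* (ii) two queries to U and two to U^* suffice *)
  (forall d : nat, (1000 < d)%N ->
     exists A : qalgo R[i] ((2 * d) * d),
       [/\ count (fun k => qkind_eqb k QU) (kinds A) = 2%N,
           count (fun k => qkind_eqb k QUconj) (kinds A) = 2%N,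
           num_queries A = 4%N &
           solves_reality_testing A]).
Proof.
split; last first.
  move=> d hd; have d0 : (0 < d)%N by apply: leq_trans hd.
  exists (reality_tester R[i] d); split=> //; exact: reality_tester_solves.
(* For T > 0, 2T+1 <= 3T^2 <= 36T^2 weakens the cubic bound to d <= 576 * 36 * T^4 = (12T)^4. *)
exists 12%:R^-1; split=> [|d hd A hA solA]; first by rewrite invr_gt0 ltr0n.
have d3 : (3 < d)%N by apply: leq_trans hd.
have := query_lower_bound (ltnW (ltnW (ltnW d3))) hA d3 solA.
set T := num_queries A => bound.
have T0 : (0 < T)%N.
  rewrite lt0n; apply: contraTneq bound => ->; rewrite muln0 -ltnNge.
  exact: ltnW (ltnW (ltnW d3)).
have bound4 : (d <= (12 * T) ^ 4)%N.
  apply: leq_trans bound _.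
  have -> : ((12 * T) ^ 4 = 576 * (36 * (T * T)) * T ^ 2)%N by ring.
  rewrite leq_mul // leq_mul // -addnn -addn1.
  have TT : (T <= T * T)%N by rewrite leq_pmulr.
  apply: leq_trans (leq_add (leq_add TT TT) (leq_trans T0 TT)) _.
  have -> : (T * T + T * T + T * T = 3 * (T * T))%N by ring.
  by rewrite leq_mul2r orbT.
rewrite ler_pdivrMl ?ltr0n // -natrM.
have -> : (12 * T)%:R = Num.sqrt (Num.sqrt ((12 * T) ^ 4)%:R) :> R.
  rewrite natrX (exprM _ 2 2) sqrtr_sqr ger0_norm ?exprn_ge0 ?ler0n //.
  by rewrite sqrtr_sqr ger0_norm ?ler0n.
by do 2!apply: ler_wsqrtr; rewrite ler_nat.
Qed.
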